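(* The nonzero Lagrangian characteristic speeds of the system of mixed ionized gas dynamics are $\lambda_\pm=\pm\lambda$, where $$\lambda=\sqrt{-\frac{\eta_T}{v_p\eta_T-v_T\eta_p}}=\frac{p}{a\sqrt{T}\,(1+\alpha)}\sqrt{\frac{\frac52(1+\alpha)\Sigma+\alpha(1+\alpha)\Phi+\Omega}{\frac32\Sigma+\alpha\Psi+\Omega}} .$$
   Context: Fixed constants: $R,M,\mu_A,\mu_B>0$, $a=\sqrt{R/M}$, $0<\beta<1$, $0<T_A<T_B\le 2T_A$. For $p>0$, $T>0$ the degrees of ionization $\alpha_A,\alpha_B\in(0,1)$ are determined by $$p=\frac{(1-\alpha_A)(1+\alpha)}{\mu_A\alpha_A\alpha}T^{5/2}e^{-T_A/T}=\frac{(1-\alpha_B)(1+\alpha)}{\mu_B\alpha_B\alpha}T^{5/2}e^{-T_B/T},\qquad \alpha=\beta\alpha_A+(1-\beta)\alpha_B .$$ Specific volume: $v=\frac{RT}{Mp}(1+\alpha)$; specific enthalpy: $h=\frac{5RT}{2M}(1+\alpha)+\frac RM[\beta T_A\alpha_A+(1-\beta)T_B\alpha_B]$; internal energy $e=h-pv$; the specific entropy $S(p,T)$ satisfies $dh=T\,dS+v\,dp$, and $\eta=\frac MR S$. Subscripts $p,T$ on $v,\eta$ denote partial derivatives in the independent variables $(p,T)$. The Lagrangian system is $v_t-u_\xi=0$, $u_t+p_\xi=0$, $(e+\frac12u^2)_t+(pu)_\xi=0$; in the state variables $(p,u,T)$ (for $C^1$ solutions, the last equation being equivalent to $\eta_t=0$)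 it reads $$p_t-\tfrac{\eta_T}{v_p\eta_T-v_T\eta_p}u_\xi=0,\quad u_t+p_\xi=0,\quad T_t+\tfrac{\eta_p}{v_p\eta_T-v_T\eta_p}u_\xi=0,$$ and its characteristic speeds are $0$ and $\lambda_\pm=\pm\sqrt{-\eta_T/(v_p\eta_T-v_T\eta_p)}$. Notation: $q_A=\alpha_A(1-\alpha_A)$, $q_B=\alpha_B(1-\alpha_B)$, $q=\beta q_A+(1-\beta)q_B$, and $$\Sigma=\alpha(1+\alpha)+q,\quad \Phi=\beta q_A\left(\tfrac52+\tfrac{T_A}{T}\right)^2+(1-\beta)q_B\left(\tfrac52+\tfrac{T_B}{T}\right)^2,$$ $$\Psi=\beta q_A\left(\tfrac{15}{4}+\tfrac{3T_A}{T}+\tfrac{T_A^2}{T^2}\right)+(1-\beta)q_B\left(\tfrac{15}{4}+\tfrac{3T_B}{T}+\tfrac{T_B^2}{T^2}\right),\quad \Omega=\beta(1-\beta)q_Aq_B\left(\tfrac{T_A}{T}-\tfrac{T_B}{T}\right)^2 .$$ *)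

(* Defs.v *)
From mathcomp Require Import all_boot all_order all_algebra.
From mathcomp Require Import all_classical all_reals all_analysis.
Import Order.TTheory GRing.Theory Num.Theory numFieldNormedType.Exports.

Set Implicit Arguments.
Unset Strict Implicit.
Unset Printing Implicit Defensive.

Local Open Scope classical_set_scope.
Local Open Scope ring_scope.

(* State functions depend on the independent variables (p, T), in this order. *)
Section PartialDerivatives.
Context {K : realType}.

Definition partial_p (f : K -> K -> K) (p T : K) : K := derive1 (fun x => f x T) p.

Definition partial_T (f : K -> K -> K) (p T : K) : K := derive1 (f p) T.

End PartialDerivatives.

Section Ionization.
Context {K : realType}.

Definition mean_ionization (beta : K) (alphaA alphaB : K -> K -> K) (p T : K) : K :=
  beta * alphaA p T + (1 - beta) * alphaB p T.

(* Right-hand side of Saha's equation for a species with constant mu,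
   ionization temperature Ti and degree of ionization ai, in a gas of mean
   degree of ionization al. *)
Definition saha_pressure (mu Ti ai al T : K) : K :=
  (1 - ai) * (1 + al) / (mu * ai * al) * T `^ (5 / 2) * expR (- Ti / T).

Definition ionization_degrees (muA muB beta TA TB : K)
    (alphaA alphaB : K -> K -> K) : Prop :=
  forall p T : K, 0 < p -> 0 < T ->
    [/\ 0 < alphaA p T < 1, 0 < alphaB p T < 1,
        p = saha_pressure muA TA (alphaA p T)
              (mean_ionization beta alphaA alphaB p T) T
      & p = saha_pressure muB TB (alphaB p T)
              (mean_ionization beta alphaA alphaB p T) T].

End Ionization.

Section Thermodynamics.
Context {K : realType}.
Variables (R M beta TA TB : K) (alphaA alphaB : K -> K -> K).

Let alpha := mean_ionization beta alphaA alphaB.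

Definition specific_volume (p T : K) : K := R * T / (M * p) * (1 + alpha p T).

Definition specific_enthalpy (p T : K) : K :=
  5 * R * T / (2 * M) * (1 + alpha p T)
  + R / M * (beta * TA * alphaA p T + (1 - beta) * TB * alphaB p T).

(* dh = T dS + v dp as an identity of differentials on the quadrant p, T > 0;
   a tangent vector is a pair d = (dp, dT). *)
Definition specific_entropy (S : K -> K -> K) : Prop :=
  forall p T : K, 0 < p -> 0 < T ->
    let S2 (x : K * K) : K := S x.1 x.2 in
    let h2 (x : K * K) : K := specific_enthalpy x.1 x.2 in
    differentiable S2 (p, T) /\
    is_diff (p, T) h2
      (fun d : K * K => T * 'd S2 (p, T) d + specific_volume p T * d.1).

Definition reduced_entropy (S : K -> K -> K) (p T : K) : K := M / R * S p T.

End Thermodynamics.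

Section LagrangianSystem.
Context {K : realType}.
Variables (v eta : K -> K -> K).

Definition vol_eta_jacobian (p T : K) : K :=
  partial_p v p T * partial_T eta p T - partial_T v p T * partial_p eta p T.

(* Coefficient matrix A of the Lagrangian system U_t + A U_xi = 0 for
   U = (p, u, T); it does not depend on u. *)
Definition lagrangian_mx (p T : K) : 'M[K]_3 :=
  \matrix_(i < 3, j < 3)
    nth 0 (nth [::]
      [:: [:: 0; - (partial_T eta p T / vol_eta_jacobian p T); 0];
          [:: 1; 0; 0];
          [:: 0; partial_p eta p T / vol_eta_jacobian p T; 0]] i) j.

(* [eigenvalue] is phrased with row vectors; for a square matrix the
   eigenvalues are the same as with column vectors. *)
Definition characteristic_speed (p T x : K) : Prop :=
  eigenvalue (lagrangian_mx p T) x.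

End LagrangianSystem.

Section Coefficients.
Context {K : realType}.
Variables (beta TA TB : K) (alphaA alphaB : K -> K -> K) (p T : K).

Let al := mean_ionization beta alphaA alphaB p T.
Let qA := alphaA p T * (1 - alphaA p T).
Let qB := alphaB p T * (1 - alphaB p T).
Let q := beta * qA + (1 - beta) * qB.

Definition Sigma_coef : K := al * (1 + al) + q.

Definition Phi_coef : K :=
  beta * qA * (5 / 2 + TA / T) ^+ 2 + (1 - beta) * qB * (5 / 2 + TB / T) ^+ 2.

Definition Psi_coef : K :=
  beta * qA * (15 / 4 + 3 * TA / T + TA ^+ 2 / T ^+ 2)
  + (1 - beta) * qB * (15 / 4 + 3 * TB / T + TB ^+ 2 / T ^+ 2).

Definition Omega_coef : K :=
  beta * (1 - beta) * qA * qB * (TA / T - TB / T) ^+ 2.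

End Coefficients.

(* Main.v *)
Require Import Defs.
From mathcomp Require Import all_boot all_order all_algebra.
From mathcomp Require Import all_classical all_reals all_analysis.
From mathcomp Require Import ring lra.
Import Order.TTheory GRing.Theory Num.Theory numFieldNormedType.Exports.
Local Open Scope classical_set_scope.
Local Open Scope ring_scope.

(** Saha's equations determine both degrees of ionization from the single
    unknown u = alpha / (1 + alpha): they read alpha_i = 1 / (1 + k_i u), where
    k_i = p mu_i T^(-5/2) exp (T_i / T), and u / (1 - u) increases with u while
    the mean of the 1 / (1 + k_i u) decreases.  Subtracting the equation
    at two points gives the increment of u as a combination of the increments
    of k_1 and k_2 with bounded coefficients; this yields first the continuity
    and then the derivative of u, hence of alpha_A and alpha_B, without the
    implicit function theorem.  The differential relation dh = T dS + v dp then
    expresses the partial derivatives of eta by those of h, and the rest is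
    a rational identity in which alpha, beta q_A and (1 - beta) q_B may be
    treated as independent variables. *)

(** * Nonzero eigenvalues of the coefficient matrix *)

(** For a row vector w the equation w A = x w reads w1 = x w0, b w0 + c w2 = x w1, 0 = x w2. As x is
    nonzero, w2 vanishes and takes c with it, leaving b w0 = x^2 w0. *)
Lemma nonzero_eigenvalue_lagrangian (F : fieldType) (b c x : F) : x != 0 ->
  eigenvalue (\matrix_(i < 3, j < 3)
    nth 0 (nth [::] [:: [:: 0; b; 0]; [:: 1; 0; 0]; [:: 0; c; 0]] i) j) x
  = (x ^+ 2 == b).
Proof.
move=> x0; apply/eigenvalueP/eqP.
- move=> [w /rowP wA w0]; have := wA 0; have := wA 1; have := wA (inord 2).
  rewrite !mxE !big_ord_recr !big_ord0 /= !mxE /= !inordK //=.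
  rewrite !(mulr0, addr0, add0r, mulr1).
  set i0 := widen_ord _ (widen_ord _ _); set i1 := widen_ord _ _.
  have <- : i0 = 0 by apply/val_inj.
  have <- : i1 = 1 by apply/val_inj.
  have <- : ord_max = inord 2 :> 'I_3 by apply/val_inj; rewrite /= inordK.
  move=> /esym/eqP; rewrite mulf_eq0 (negPf x0) /= => /eqP w2.
  rewrite w2 mul0r addr0 => + w1; rewrite w1 => e.
  (* If w0 vanished, so would w1 = x w0, and with w2 = 0 the whole vector. *)
  have wi0 : w 0 i0 != 0.
    apply: contra w0 => /eqP wi0; apply/eqP/rowP => j; rewrite mxE.
    rewrite wi0 mulr0 in w1.
    by case: j => -[|[|[|//]]] hj; [rewrite -[RHS]wi0|rewrite -[RHS]w1|rewrite -[RHS]w2];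
      congr (w _ _); apply/val_inj.
  by apply: (mulfI wi0); rewrite e; ring.
- move=> <-; exists (\row_j nth 0 [:: 1; x; 0] j).
    apply/rowP => j; rewrite !mxE !big_ord_recr !big_ord0 /= !mxE /=.
    by case: j => -[|[|[|//]]] hj /=; ring.
  by apply/eqP => /rowP/(_ 0); rewrite !mxE /= => /eqP; rewrite oner_eq0.
Qed.

(** * Derivatives in one variable as limits of difference quotients *)

Lemma is_derive1P (K : realType) (f : K -> K) (s d : K) :
  (fun h => h^-1 * (f (h + s) - f s)) @ 0^' --> d <-> is_derive s 1 f d.
Proof.
have E : (fun h => h^-1 * (f (h + s) - f s)) =
         (fun h : K => h^-1 *: ((f \o shift s) (h *: (1 : K)) - f s)).
  by apply/funext => h /=; rewrite [h *: 1]mulr1.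
rewrite E; split => [cv|[df <-]].
  by split; [apply/cvg_ex; exists d|exact/cvg_lim].
exact: df.
Qed.

(** Divide the increment identity by x - s and let x tend to s: only the limits of [g1] and [g2] at
    s enter, so their continuity there suffices. *)
Lemma is_derive_secant (K : realType) (f k1 k2 g1 g2 : K -> K) (s d1 d2 : K) :
  (\forall x \near s,
     f x - f s = g1 x * (k1 x - k1 s) + g2 x * (k2 x - k2 s)) ->
  {for s, continuous g1} -> {for s, continuous g2} ->
  is_derive s 1 k1 d1 -> is_derive s 1 k2 d2 ->
  is_derive s 1 f (g1 s * d1 + g2 s * d2).
Proof.
move=> fE cg1 cg2 /is_derive1P dk1 /is_derive1P dk2; apply/is_derive1P.
have sh : (h + s) @[h --> 0^'] --> s.
  apply: cvg_within_filter.
  have : (h + s) @[h --> (0 : K)] --> 0 + s.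
    by apply: cvgD; [exact: cvg_id|exact: cvg_cst].
  by rewrite add0r.
have fE' : {near (0 : K)^', (fun h => g1 (h + s) * (h^-1 * (k1 (h + s) - k1 s))
      + g2 (h + s) * (h^-1 * (k2 (h + s) - k2 s)))
    =1 (fun h => h^-1 * (f (h + s) - f s))}.
  have fEs : \forall h \near (0 : K)^', f (h + s) - f s =
      g1 (h + s) * (k1 (h + s) - k1 s) + g2 (h + s) * (k2 (h + s) - k2 s).
    exact: (sh _ fE).
  by near=> h; rewrite (near fEs h) //; ring.
suff lim : (fun h => g1 (h + s) * (h^-1 * (k1 (h + s) - k1 s))
      + g2 (h + s) * (h^-1 * (k2 (h + s) - k2 s))) @ 0^' --> g1 s * d1 + g2 s * d2.
  exact: (cvg_trans (near_eq_cvg fE') lim).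
apply: cvgD; apply: cvgM => //.
- exact: (cvg_comp _ _ sh cg1).
- exact: (cvg_comp _ _ sh cg2).
Unshelve. all: by end_near. Qed.

(** * Differentiating Saha's equations in a single variable *)

Section SahaDerivative.
Context (K : realType) (beta : K) (a b k1 k2 : K -> K) (s m1 m2 : K).
Hypotheses (beta_gt0 : 0 < beta) (beta_lt1 : beta < 1).

Let al x := beta * a x + (1 - beta) * b x.

Let saha_at x := [/\ 0 < a x < 1, 0 < b x < 1,
      (1 - a x) * (1 + al x) = k1 x * a x * al x
    & (1 - b x) * (1 + al x) = k2 x * b x * al x].

Hypothesis saha : \forall x \near s, saha_at x.
(** The normalization makes [m1] and [m2] the logarithmic derivatives of [k1] and [k2]; the
    coefficients themselves then drop out of the final formulas. *)
Hypotheses (dk1 : is_derive s 1 k1 (m1 * k1 s))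
           (dk2 : is_derive s 1 k2 (m2 * k2 s)).

Let u x := al x / (1 + al x).
(* D x (u x - u s) is linear in the increments of k1 and k2. *)
Let D x := (1 + al s) * (1 + al x) + beta * k1 x * a s * a x
           + (1 - beta) * k2 x * b s * b x.
Let g1 x := - (u s * beta * a s * a x / D x).
Let g2 x := - (u s * (1 - beta) * b s * b x / D x).

(** Dividing by 1 + alpha turns Saha's equation into 1 - a = k a u, which is solved for a. The sign
    of k is read off from the positivity of the left-hand side. *)
Let saha_u x : saha_at x ->
  [/\ 0 < al x, 0 < k1 x, 0 < k2 x,
    a x = (1 + k1 x * u x)^-1 & b x = (1 + k2 x * u x)^-1].
Proof.
move=> [/andP[a0 a1] /andP[b0 b1] ea eb].
have al0 : 0 < al x by rewrite addr_gt0 ?mulr_gt0 ?subr_gt0.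
have w0 : 0 < 1 + al x by rewrite addr_gt0.
have kpos (k c : K) : 0 < c -> c < 1 -> (1 - c) * (1 + al x) = k * c * al x -> 0 < k.
  move=> c0 c1 e; have : 0 < k * c * al x by rewrite -e mulr_gt0 ?subr_gt0.
  by rewrite pmulr_lgt0 // pmulr_lgt0.
have inv (k c : K) : 0 < c -> c < 1 -> (1 - c) * (1 + al x) = k * c * al x ->
    c = (1 + k * u x)^-1.
  move=> c0 c1 e; have k0 := kpos _ _ c0 c1 e.
  have ku : 0 < 1 + k * u x by rewrite addr_gt0 ?mulr_gt0 ?invr_gt0.
  apply: (mulIf (lt0r_neq0 ku)); rewrite mulVf ?lt0r_neq0 //.
  apply: (mulIf (lt0r_neq0 w0)); rewrite /u mul1r.
  have -> : c * (1 + k * (al x / (1 + al x))) * (1 + al x)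
     = c * (1 + al x) + k * c * al x by field; exact: lt0r_neq0.
  by rewrite -e; ring.
split=> //; [exact: kpos ea|exact: kpos eb|exact: inv ea|exact: inv eb].
Qed.

(** From alpha = u / (1 - u), the increment of alpha is that of u times (1 + al s)(1 + al x). On the
    other hand a x - a s = a x a s (k1 s u s - k1 x u x), where k1 x u x - k1 s u s = k1 x (u x - u
    s) + u s (k1 x - k1 s), and likewise for b. Collecting the terms in u x - u s on one side
    produces the factor D x. *)
Let secant_u : \forall x \near s,
  u x - u s = g1 x * (k1 x - k1 s) + g2 x * (k2 x - k2 s) /\ 1 < D x.
Proof.
near=> x.
have sahas := nbhs_singleton saha.
have sahax : saha_at x by near: x.
have [als k1s k2s eas ebs] := saha_u s sahas.
have [alx k1x k2x eax ebx] := saha_u x sahax.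
have [/andP[a0 _] /andP[b0 _] _ _] := sahax.
have [/andP[as0 _] /andP[bs0 _] _ _] := sahas.
have ws0 : 0 < 1 + al s by rewrite addr_gt0.
have wx0 : 0 < 1 + al x by rewrite addr_gt0.
have D1 : 1 < D x.
  rewrite /D; set y := beta * _ * _ * _; set z := (1 - beta) * _ * _ * _.
  have y0 : 0 < y by rewrite !mulr_gt0.
  have z0 : 0 < z by rewrite !mulr_gt0 ?subr_gt0.
  by have : 0 < al s * al x; [rewrite mulr_gt0|lra].
split => //.
have D0 : D x != 0 by rewrite gt_eqF ?(lt_trans ltr01).
have inv_sub (k l c d m n : K) : 0 < c -> 0 < d -> c = (1 + k * m)^-1 ->
    d = (1 + l * n)^-1 -> c - d = c * d * (l * n - k * m).
  move=> c0 d0 ec ed.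
  have km0 : 1 + k * m != 0 by rewrite -invr_eq0 -ec gt_eqF.
  have ln0 : 1 + l * n != 0 by rewrite -invr_eq0 -ed gt_eqF.
  by rewrite ec ed; field; rewrite km0 ln0.
have uW : (u x - u s) * ((1 + al s) * (1 + al x)) = al x - al s.
  by rewrite /u; field; rewrite !lt0r_neq0.
have alE : al x - al s = beta * (a x - a s) + (1 - beta) * (b x - b s).
  by rewrite /al; ring.
have /eqP : (u x - u s) * D x = - (u s * beta * a s * a x * (k1 x - k1 s))
     - u s * (1 - beta) * b s * b x * (k2 x - k2 s).
  rewrite /D -addrA mulrDr uW alE.
  rewrite (inv_sub _ _ _ _ _ _ a0 as0 eax eas) (inv_sub _ _ _ _ _ _ b0 bs0 ebx ebs).
  by ring.
rewrite -(inj_eq (mulIf (invr_neq0 D0))) mulfK // => /eqP ->.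
by rewrite /g1 /g2; field.
Unshelve. all: by end_near. Qed.

Let cont_k1 : {for s, continuous k1}.
Proof. by apply/differentiable_continuous/derivable1_diffP; case: dk1. Qed.

Let cont_k2 : {for s, continuous k2}.
Proof. by apply/differentiable_continuous/derivable1_diffP; case: dk2. Qed.

(** Continuity of a and b is not yet available, but [g1] and [g2] are bounded by 1: up to sign each
    is a product of four numbers in (0, 1) divided by D x > 1. Hence |u x - u s| <= e x, which tends
    to 0. *)
Let cont_u : {for s, continuous u}.
Proof.
pose e x := `|k1 x - k1 s| + `|k2 x - k2 s|.
have e0 : e x @[x --> s] --> 0.
  have : e x @[x --> s] --> `|k1 s - k1 s| + `|k2 s - k2 s|.
    apply: cvgD; apply: cvg_norm; apply: cvgB;
      by [exact: cont_k1|exact: cont_k2|exact: cvg_cst].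
  by rewrite !subrr normr0 addr0.
apply: (@squeeze_cvgr _ _ _ _ (fun x => u s - e x) (fun x => u s + e x)); last 2 first.
- have : (u s - e x) @[x --> s] --> u s - 0 by apply: cvgB => //; exact: cvg_cst.
  by rewrite subr0.
- have : (u s + e x) @[x --> s] --> u s + 0 by apply: cvgD => //; exact: cvg_cst.
  by rewrite addr0.
near=> x; rewrite -ler_distl.
have [-> D1] : u x - u s = g1 x * (k1 x - k1 s) + g2 x * (k2 x - k2 s) /\ 1 < D x.
  by near: x; exact: secant_u.
have sahas := nbhs_singleton saha.
have sahax : saha_at x by near: x.
have [als _ _ _ _] := saha_u s sahas.
have [/andP[a0 a1] /andP[b0 b1] _ _] := sahax.
have [/andP[as0 as1] /andP[bs0 bs1] _ _] := sahas.
have us0 : 0 < u s by rewrite /u divr_gt0 // addr_gt0.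
have us1 : u s < 1 by rewrite /u ltr_pdivrMr ?mul1r ?ltrDr // addr_gt0.
have small (w c y z d : K) : 0 < w < 1 -> 0 < c < 1 -> 0 < y < 1 -> 0 < z < 1 ->
    1 < d -> `|- (w * c * y * z / d)| <= 1.
  move=> /andP[w0 w1] /andP[c0 c1] /andP[y0 y1] /andP[z0 z1] d1.
  have d0 : 0 < d by exact: lt_trans d1.
  rewrite normrN gtr0_norm; last by rewrite divr_gt0 // !mulr_gt0.
  rewrite ler_pdivrMr // mul1r (le_trans _ (ltW d1)) //.
  by rewrite !mulr_ile1 ?mulr_ge0 ?ltW.
rewrite (le_trans (ler_normD _ _)) // lerD // normrM ler_piMl // small //;
  by rewrite ?us0 ?beta_gt0 ?a0 ?b0 ?as0 ?bs0 // subr_gt0 beta_lt1 gtrBl beta_gt0.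
Unshelve. all: by end_near. Qed.

Let denom_neq0 : 1 + k1 s * u s != 0 /\ 1 + k2 s * u s != 0.
Proof.
have sahas := nbhs_singleton saha; have [/andP[a0 _] /andP[b0 _] _ _] := sahas.
have [_ _ _ ea eb] := saha_u s sahas.
by split; rewrite -invr_eq0 -?ea -?eb gt_eqF.
Qed.

Let aE : {near s, (fun x => (1 + k1 x * u x)^-1) =1 a}.
Proof. by near=> x; have [|_ _ _ <-] := saha_u x; first by near: x.
Unshelve. all: by end_near. Qed.

Let bE : {near s, (fun x => (1 + k2 x * u x)^-1) =1 b}.
Proof. by near=> x; have [|_ _ _ _ <-] := saha_u x; first by near: x.
Unshelve. all: by end_near. Qed.

Let cont_inv (f k : K -> K) : {near s, (fun x => (1 + k x * u x)^-1) =1 f} ->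
  {for s, continuous k} -> 1 + k s * u s != 0 -> {for s, continuous f}.
Proof.
move=> fE ck d0.
have cv : (fun x => (1 + k x * u x)^-1) x @[x --> s] --> (1 + k s * u s)^-1.
  by apply: cvgV => //; apply: cvgD; [exact: cvg_cst|exact: cvgM].
rewrite (nbhs_singleton fE) in cv.
exact: (cvg_trans (near_eq_cvg fE) cv).
Qed.

Let cont_a : {for s, continuous a}.
Proof. by have [d _] := denom_neq0; exact: cont_inv aE cont_k1 d. Qed.

Let cont_b : {for s, continuous b}.
Proof. by have [_ d] := denom_neq0; exact: cont_inv bE cont_k2 d. Qed.

Let cont_D : {for s, continuous D}.
Proof.
have cc (f : K -> K) (c : K) : {for s, continuous f} -> {for s, continuous (fun x => c * f x)}.
  by move=> cf; apply: cvgM => //; exact: cvg_cst.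
have cal : {for s, continuous al} by apply: cvgD; apply: cc.
apply: cvgD; [apply: cvgD|].
- by apply: cc; apply: cvgD; [exact: cvg_cst|].
- by apply: cvgM => //; apply: cvgM; [exact: cc|exact: cvg_cst].
- by apply: cvgM => //; apply: cvgM; [exact: cc|exact: cvg_cst].
Qed.

Let D_gt1 : 1 < D s.
Proof. by have [] := nbhs_singleton secant_u. Qed.

Let cont_g (c : K) (f : K -> K) : {for s, continuous f} ->
  {for s, continuous (fun x => - (c * f x / D x))}.
Proof.
move=> cf; apply: cvgN; apply: cvgM; first by apply: cvgM => //; exact: cvg_cst.
by apply: cvgV => //; rewrite gt_eqF // (lt_trans ltr01).
Qed.

Let q1 := a s * (1 - a s).
Let q2 := b s * (1 - b s).
(* The logarithmic derivative of u at s. *)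
Let n := - (beta * q1 * m1 + (1 - beta) * q2 * m2)
         / (al s * (1 + al s) + (beta * q1 + (1 - beta) * q2)).

(** Continuity of u passes to a and b through a = 1 / (1 + k1 u), hence to [g1] and [g2], and the
    secant identity can be taken to the limit. Saha's equations at s then eliminate [k1] and
    [k2]. *)
Let is_derive_u : is_derive s 1 u (n * u s).
Proof.
have du : is_derive s 1 u (g1 s * (m1 * k1 s) + g2 s * (m2 * k2 s)).
  apply: is_derive_secant dk1 dk2; try exact: cont_g.
  by apply: filterS secant_u => x [].
apply: (is_derive_eq du).
have sahas := nbhs_singleton saha; have [/andP[a0 a1] /andP[b0 b1] sa sb] := sahas.
have [als _ _ ea eb] := saha_u s sahas.
have w0 : 0 < 1 + al s by rewrite addr_gt0.
have k1E : k1 s = (1 - a s) * (1 + al s) / (a s * al s).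
  by rewrite sa; field; rewrite !gt_eqF.
have k2E : k2 s = (1 - b s) * (1 + al s) / (b s * al s).
  by rewrite sb; field; rewrite !gt_eqF.
have q10 : 0 < beta * q1 by rewrite !mulr_gt0 ?subr_gt0.
have q20 : 0 < (1 - beta) * q2 by rewrite !mulr_gt0 ?subr_gt0.
have S0 : 0 < al s * (1 + al s) + (beta * q1 + (1 - beta) * q2).
  by apply: addr_gt0; [exact: mulr_gt0|exact: addr_gt0].
(* Saha's equation gives k a^2 = a (1 - a) (1 + alpha) / alpha for each species; this is where Sigma
   appears. *)
have DE : D s = (1 + al s) / al s * (al s * (1 + al s) + (beta * q1 + (1 - beta) * q2)).
  rewrite /D k1E k2E /q1 /q2; field.
  by rewrite !gt_eqF.
rewrite /g1 /g2 DE k1E k2E /n /u; move: S0; rewrite /q1 /q2 => S0.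
by field; rewrite !gt_eqF.
Qed.

(** In a = 1 / (1 + k1 u) the product k1 u has logarithmic derivative n + m1, and k1 u / (1 + k1
    u)^2 = a (1 - a). *)
Lemma saha_is_derive :
  is_derive s 1 a (- (q1 * (n + m1))) /\ is_derive s 1 b (- (q2 * (n + m2))).
Proof.
have [d10 d20] := denom_neq0.
have [/andP[a0 _] /andP[b0 _] _ _] := nbhs_singleton saha.
have [als _ _ ea eb] := saha_u s (nbhs_singleton saha).
have dinv (k : K -> K) (m : K) : is_derive s 1 k m -> 1 + k s * u s != 0 ->
    is_derive s 1 (fun x => (1 + k x * u x)^-1)
      (- (1 + k s * u s) ^- 2 * (k s * (n * u s) + u s * m)).
  move=> dk d0; apply: is_deriveV => //.
  rewrite -[X in is_derive _ _ _ X]add0r; apply: is_deriveD.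
  exact: is_deriveM dk is_derive_u.
split.
- apply: (near_eq_is_derive aE); apply: (is_derive_eq (dinv _ _ dk1 d10)).
  by rewrite /q1 ea; field.
- apply: (near_eq_is_derive bE); apply: (is_derive_eq (dinv _ _ dk2 d20)).
  by rewrite /q2 eb; field.
Qed.

End SahaDerivative.

(** * Partial derivatives read off from total differentials *)

Lemma is_derive_fst (K : realType) (f : K -> K -> K) (p T : K) :
  differentiable (fun x : K * K => f x.1 x.2) (p, T) ->
  is_derive p 1 (fun x => f x T) ('d (fun x : K * K => f x.1 x.2) (p, T) (1, 0)).
Proof.
set F := fun x : K * K => _ => dF; apply/is_derive1P.
have := @diff_derivable _ _ _ F (p, T) (1, 0) dF; have := @deriveE _ _ _ F (p, T) (1, 0) dF.
rewrite /derivable /derive => ->.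
suff -> : (fun h => h^-1 * (f (h + p) T - f p T)) =
    (fun h : K => h^-1 *: ((F \o shift (p, T)) (h *: (1, 0)) - F (p, T))) by [].
by apply/funext => h; rewrite /F /= scaler0 add0r [h *: 1]mulr1.
Qed.

Lemma is_derive_snd (K : realType) (f : K -> K -> K) (p T : K) :
  differentiable (fun x : K * K => f x.1 x.2) (p, T) ->
  is_derive T 1 (f p) ('d (fun x : K * K => f x.1 x.2) (p, T) (0, 1)).
Proof.
set F := fun x : K * K => _ => dF; apply/is_derive1P.
have := @diff_derivable _ _ _ F (p, T) (0, 1) dF; have := @deriveE _ _ _ F (p, T) (0, 1) dF.
rewrite /derivable /derive => ->.
suff -> : (fun h => h^-1 * (f p (h + T) - f p T)) =
    (fun h : K => h^-1 *: ((F \o shift (p, T)) (h *: (0, 1)) - F (p, T))) by [].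
by apply/funext => h; rewrite /F /= scaler0 add0r [h *: 1]mulr1.
Qed.

(** Evaluating dh = T dS + v dp on the tangent vectors (1, 0) and (0, 1) gives h_p = T S_p + v and
    h_T = T S_T. *)
Lemma entropy_partials (K : realType) (R M beta TA TB : K)
    (alphaA alphaB S : K -> K -> K) (p T : K) :
  specific_entropy R M beta TA TB alphaA alphaB S -> 0 < p -> 0 < T ->
  let h := specific_enthalpy R M beta TA TB alphaA alphaB in
  partial_p (reduced_entropy R M S) p T =
    M / R * ((partial_p h p T - specific_volume R M beta alphaA alphaB p T) / T) /\
  partial_T (reduced_entropy R M S) p T = M / R * (partial_T h p T / T).
Proof.
move=> SP p0 T0 h; have [dS [dh hE]] := SP p T p0 T0.
have T_neq0 : T != 0 by rewrite gt_eqF.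
have Sp := is_derive_fst _ _ _ _ dS; have ST := is_derive_snd _ _ _ _ dS.
have hp := is_derive_fst _ _ _ _ dh; have hT := is_derive_snd _ _ _ _ dh.
rewrite /partial_p /partial_T !derive1E.
rewrite (@derive_val _ _ _ _ _ _ _ hp) (@derive_val _ _ _ _ _ _ _ hT) hE /=.
rewrite mulr1 mulr0 addr0 addrK ![T * _]mulrC !mulfK //.
split.
- exact: (@derive_val _ _ _ _ _ _ _ (is_deriveZ (M / R) Sp)).
- exact: (@derive_val _ _ _ _ _ _ _ (is_deriveZ (M / R) ST)).
Qed.

(** * The coefficients k_i and their logarithmic derivatives *)

Definition saha_coef {K : realType} (mu Ti p T : K) : K :=
  p * (mu / (T `^ (5 / 2) * expR (- Ti / T))).

Lemma saha_pressure_coef (K : realType) (mu Ti ai al p T : K) :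
  0 < mu -> 0 < T -> 0 < ai -> 0 < al -> p = saha_pressure mu Ti ai al T ->
  (1 - ai) * (1 + al) = saha_coef mu Ti p T * ai * al.
Proof.
move=> mu0 T0 ai0 al0 ->; rewrite /saha_pressure /saha_coef.
have w0 := powR_gt0 (5 / 2) T0; have e0 := expR_gt0 (- Ti / T).
by field; rewrite !gt_eqF.
Qed.

Lemma is_derive_saha_coef_p (K : realType) (mu Ti p T : K) : p != 0 ->
  is_derive p 1 (fun x => saha_coef mu Ti x T) (p^-1 * saha_coef mu Ti p T).
Proof.
move=> p0; rewrite /saha_coef; move: (mu / _) => c.
have d := is_deriveM (is_derive_id p (1 : K)) (is_derive_cst c p (1 : K)).
by apply: (is_derive_eq d); rewrite mulKf // /GRing.scale /=; ring.
Qed.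

Lemma is_derive_saha_coef_T (K : realType) (mu Ti p T : K) : 0 < T ->
  is_derive T 1 (saha_coef mu Ti p)
    (- (T^-1 * (5 / 2 + Ti / T)) * saha_coef mu Ti p T).
Proof.
move=> T0; have T_neq0 : T != 0 by rewrite gt_eqF.
have w0 := powR_gt0 (5 / 2) T0; have e0 := expR_gt0 (- Ti / T).
have dw := is_derive1_powR (5 / 2) T0.
have di : is_derive T 1 (fun x => - Ti / x) (- Ti * (- T ^- 2 * 1)).
  by apply: is_deriveZ; apply: is_deriveV.
have de : is_derive T 1 (fun x => expR (- Ti / x)) (expR (- Ti / T) * (- Ti * (- T ^- 2 * 1))).
  exact: (is_derive1_comp _ di).
pose f x := x `^ (5 / 2) * expR (- Ti / x).
have df : is_derive T 1 f _ := is_deriveM dw de.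
have f_neq0 : f T != 0 by rewrite gt_eqF ?mulr_gt0.
have d := is_deriveZ p (is_deriveZ mu (is_deriveV f_neq0 df)).
apply: (is_derive_eq d); rewrite /saha_coef /GRing.scale /f /=.
(* The power rule leaves the exponent 5/2 - 1; splitting off T^-1 makes every term rational in T and
   T^(5/2). *)
rewrite powRD; last by rewrite T_neq0 implybT.
rewrite powR_inv1 ?ltW //.
by field; rewrite T_neq0 !gt_eqF.
Qed.

(** * Rational identities for eta_T and the Jacobian *)

Section ClosedForm.
(* al, cA, cB, x, y stand for alpha, beta q_A, (1 - beta) q_B, T_A / T, T_B / T;
   Ap, AT, Bp, BT are the derivatives of beta alpha_A and (1 - beta) alpha_B. *)
Variables (K : realType) (R M p T al cA cB x y : K).
Hypotheses (R0 : R != 0) (M0 : M != 0) (p0 : p != 0) (T0 : T != 0).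

Let Sigma := al * (1 + al) + (cA + cB).
(** [np] and [nT] are the logarithmic derivatives of u = alpha / (1 + alpha) in p and in T. *)
Let np := - (cA + cB) / (p * Sigma).
Let nT := (cA * (5 / 2 + x) + cB * (5 / 2 + y)) / (T * Sigma).
Let Ap := - cA * (np + p^-1).
Let Bp := - cB * (np + p^-1).
Let AT := - cA * (nT - (5 / 2 + x) / T).
Let BT := - cB * (nT - (5 / 2 + y) / T).
Let v := R * T / (M * p) * (1 + al).
Let vp := R * T / (M * p) * (Ap + Bp - (1 + al) / p).
Let vT := R * T / (M * p) * (AT + BT + (1 + al) / T).
Let hp := R * T / M * ((5 / 2 + x) * Ap + (5 / 2 + y) * Bp).
Let hT := R * T / M * (5 / 2 * (1 + al) / T + (5 / 2 + x) * AT + (5 / 2 + y) * BT).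
Let etap := M / R * ((hp - v) / T).
Let etaT := M / R * (hT / T).
Let Omega := cA * cB * (x - y) ^+ 2.

(** With z_i = 5/2 + T_i / T and c_i for [cA], [cB], substitution leaves sum c_i z_i^2 - (sum c_i
    z_i)^2 / Sigma next to 5/2 (1 + al). Lagrange's identity (cA + cB) sum c_i z_i^2 - (sum c_i
    z_i)^2 = Omega brings in Omega. *)
Lemma etaT_closed_form : Sigma != 0 ->
  etaT = (5 / 2 * (1 + al) * Sigma
          + al * (1 + al) * (cA * (5 / 2 + x) ^+ 2 + cB * (5 / 2 + y) ^+ 2)
          + Omega) / (T * Sigma).
Proof.
rewrite /etaT /hT /AT /BT /nT /Omega /Sigma => S0.
by field; rewrite S0 R0 M0 T0.
Qed.

(** Here etap = - (M / R) vT, a Maxwell relation, so the left-hand side is vp etaT + (M / R) vT^2.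
    One factor of the denominator Sigma^2 cancels. The weight 15/4 + 3 x + x^2 is z^2 - 2 z + 5/2
    with z = 5/2 + x. *)
Lemma jacobian_closed_form : Sigma != 0 ->
  vp * etaT - vT * etap =
  - (R / M * (1 + al) ^+ 2 / (p ^+ 2 * Sigma)
     * (3 / 2 * Sigma + al * (cA * (15 / 4 + 3 * x + x ^+ 2)
                              + cB * (15 / 4 + 3 * y + y ^+ 2)) + Omega)).
Proof.
rewrite /vp /vT /etap /etaT /hp /hT /v /Ap /Bp /AT /BT /np /nT /Omega /Sigma => S0.
by field; rewrite S0 p0 R0 M0 T0.
Qed.

End ClosedForm.

(** * Partial derivatives of the ionization degrees, volume and enthalpy *)

Section Partials.
Context {K : realType}.
Variables (R M muA muB beta TA TB : K) (alphaA alphaB : K -> K -> K) (p T : K).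
Hypotheses (muA_gt0 : 0 < muA) (muB_gt0 : 0 < muB)
  (beta_gt0 : 0 < beta) (beta_lt1 : beta < 1) (M_neq0 : M != 0)
  (alphaP : ionization_degrees muA muB beta TA TB alphaA alphaB)
  (p_gt0 : 0 < p) (T_gt0 : 0 < T).

Let al := mean_ionization beta alphaA alphaB.
Let qA := alphaA p T * (1 - alphaA p T).
Let qB := alphaB p T * (1 - alphaB p T).
Let Sigma := al p T * (1 + al p T) + (beta * qA + (1 - beta) * qB).
Let np := - (beta * qA + (1 - beta) * qB) / (p * Sigma).
Let nT := (beta * qA * (5 / 2 + TA / T) + (1 - beta) * qB * (5 / 2 + TB / T))
          / (T * Sigma).

Lemma Sigma_gt0 : 0 < Sigma.
Proof.
have [/andP[a0 a1] /andP[b0 b1] _ _] := alphaP _ _ p_gt0 T_gt0.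
have al0 : 0 < al p T by rewrite /al /mean_ionization addr_gt0 ?mulr_gt0 ?subr_gt0.
apply: addr_gt0; first by rewrite mulr_gt0 // addr_gt0.
by rewrite /qA /qB addr_gt0 ?mulr_gt0 ?subr_gt0.
Qed.

Lemma saha_equations (x y : K) : 0 < x -> 0 < y ->
  [/\ 0 < alphaA x y < 1, 0 < alphaB x y < 1,
    (1 - alphaA x y) * (1 + al x y) = saha_coef muA TA x y * alphaA x y * al x y
  & (1 - alphaB x y) * (1 + al x y) = saha_coef muB TB x y * alphaB x y * al x y].
Proof.
move=> x0 y0; have [a01 b01 ea eb] := alphaP _ _ x0 y0.
have [/andP[a0 a1] /andP[b0 b1]] := (a01, b01).
have al0 : 0 < al x y by rewrite /al /mean_ionization addr_gt0 ?mulr_gt0 ?subr_gt0.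
by split=> //; apply: saha_pressure_coef.
Qed.

(** Both k_i are proportional to p, so the two logarithmic derivatives equal 1 / p. *)
Lemma is_derive_ionization_p :
  is_derive p 1 (fun x => alphaA x T) (- (qA * (np + p^-1))) /\
  is_derive p 1 (fun x => alphaB x T) (- (qB * (np + p^-1))).
Proof.
have p_neq0 : p != 0 by rewrite gt_eqF.
have S0 := Sigma_gt0.
have [] := @saha_is_derive _ beta (fun x => alphaA x T) (fun x => alphaB x T)
    (fun x => saha_coef muA TA x T) (fun x => saha_coef muB TB x T) p p^-1 p^-1
    beta_gt0 beta_lt1 _ (is_derive_saha_coef_p _ _ _ _ _ p_neq0)
    (is_derive_saha_coef_p _ _ _ _ _ p_neq0).
  by near=> x; apply: saha_equations => //; near: x; exact: lt_nbhsr.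
rewrite -/qA -/qB -/(al p T) -/Sigma => dA dB.
have npE : - (beta * qA * p^-1 + (1 - beta) * qB * p^-1) / Sigma = np.
  by rewrite /np; field; rewrite p_neq0 gt_eqF.
by rewrite -npE.
Unshelve. all: by end_near. Qed.

Lemma is_derive_ionization_T :
  is_derive T 1 (alphaA p) (- (qA * (nT - (5 / 2 + TA / T) / T))) /\
  is_derive T 1 (alphaB p) (- (qB * (nT - (5 / 2 + TB / T) / T))).
Proof.
have T_neq0 : T != 0 by rewrite gt_eqF.
have S0 := Sigma_gt0.
have [] := @saha_is_derive _ beta (alphaA p) (alphaB p)
    (saha_coef muA TA p) (saha_coef muB TB p) T _ _
    beta_gt0 beta_lt1 _ (is_derive_saha_coef_T _ _ _ _ _ T_gt0)
    (is_derive_saha_coef_T _ _ _ _ _ T_gt0).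
  by near=> x; apply: saha_equations => //; near: x; exact: lt_nbhsr.
rewrite -/qA -/qB -/(al p T) -/Sigma => dA dB.
have nTE : - (beta * qA * - (T^-1 * (5 / 2 + TA / T))
    + (1 - beta) * qB * - (T^-1 * (5 / 2 + TB / T))) / Sigma = nT.
  by rewrite /nT; field; rewrite T_neq0 gt_eqF.
by rewrite [(_ + TA / T) / T]mulrC [(_ + TB / T) / T]mulrC -nTE.
Unshelve. all: by end_near. Qed.

Let cA := beta * qA.
Let cB := (1 - beta) * qB.
Let x := TA / T.
Let y := TB / T.
Let Ap := - cA * (np + p^-1).
Let Bp := - cB * (np + p^-1).
Let AT := - cA * (nT - (5 / 2 + x) / T).
Let BT := - cB * (nT - (5 / 2 + y) / T).
Let v := specific_volume R M beta alphaA alphaB.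
Let h := specific_enthalpy R M beta TA TB alphaA alphaB.

(** Writing T_A = T x and T_B = T y extracts the common factor R T / M from h_p, which matches the
    shape used in the closed forms. *)
Lemma partial_p_volume_enthalpy :
  partial_p v p T = R * T / (M * p) * (Ap + Bp - (1 + al p T) / p) /\
  partial_p h p T = R * T / M * ((5 / 2 + x) * Ap + (5 / 2 + y) * Bp).
Proof.
have p_neq0 : p != 0 by rewrite gt_eqF.
have T_neq0 : T != 0 by rewrite gt_eqF.
have [dA dB] := is_derive_ionization_p.
have dal : is_derive p 1 (fun z => 1 + al z T) (Ap + Bp).
  have d := is_deriveD (is_derive_cst (1 : K) p (1 : K))
    (is_deriveD (is_deriveZ beta dA) (is_deriveZ (1 - beta) dB)).
  apply: (is_derive_eq d).
  by rewrite /Ap /Bp /cA /cB /GRing.scale /=; ring.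
have Mp0 : M * p != 0 by rewrite mulf_neq0.
have dv : is_derive p 1 (fun z => R * T * (M * z)^-1)
    (R * T * (- (M * p) ^- 2 * (M * 1))).
  by apply: is_deriveZ; apply: is_deriveV => //; apply: is_deriveZ.
rewrite /partial_p !derive1E; split.
  rewrite (@derive_val _ _ _ _ _ _ _ (is_deriveM dv dal)) /GRing.scale /=.
  by field; rewrite p_neq0.
have dh := is_deriveD (is_deriveZ (5 * R * T / (2 * M)) dal)
  (is_deriveZ (R / M) (is_deriveD (is_deriveZ (beta * TA) dA)
                                  (is_deriveZ ((1 - beta) * TB) dB))).
rewrite (@derive_val _ _ _ _ _ _ _ dh) /GRing.scale /= /Ap /Bp /cA /cB /x /y.
by field; rewrite p_neq0 T_neq0.
Qed.

Lemma partial_T_volume_enthalpy :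
  partial_T v p T = R * T / (M * p) * (AT + BT + (1 + al p T) / T) /\
  partial_T h p T =
    R * T / M * (5 / 2 * (1 + al p T) / T + (5 / 2 + x) * AT + (5 / 2 + y) * BT).
Proof.
have p_neq0 : p != 0 by rewrite gt_eqF.
have T_neq0 : T != 0 by rewrite gt_eqF.
have [dA dB] := is_derive_ionization_T.
have dal : is_derive T 1 (fun z => 1 + al p z) (AT + BT).
  have d := is_deriveD (is_derive_cst (1 : K) T (1 : K))
    (is_deriveD (is_deriveZ beta dA) (is_deriveZ (1 - beta) dB)).
  apply: (is_derive_eq d).
  by rewrite /AT /BT /cA /cB /x /y /GRing.scale /=; ring.
have dlin (c d : K) : is_derive T 1 (fun z => c * z / d) (c / d).
  have dc := is_deriveM (is_deriveZ c (is_derive_id T (1 : K))) (is_derive_cst (d^-1) T (1 : K)).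
  apply: (is_derive_eq dc); rewrite /GRing.scale /=; ring.
rewrite /partial_T !derive1E; split.
  rewrite (@derive_val _ _ _ _ _ _ _ (is_deriveM (dlin R (M * p)) dal)) /GRing.scale /=.
  by field; rewrite p_neq0 T_neq0.
have dh := is_deriveD (is_deriveM (dlin (5 * R) (2 * M)) dal)
  (is_deriveZ (R / M) (is_deriveD (is_deriveZ (beta * TA) dA)
                                  (is_deriveZ ((1 - beta) * TB) dB))).
rewrite (@derive_val _ _ _ _ _ _ _ dh) /GRing.scale /= /AT /BT /cA /cB /x /y.
by field; rewrite ?p_neq0 T_neq0.
Qed.

End Partials.

(** * The characteristic speeds *)

Theorem theorem2 (K : realType) (R M muA muB beta TA TB : K)
    (alphaA alphaB S : K -> K -> K)
    (R_gt0 : 0 < R) (M_gt0 : 0 < M) (muA_gt0 : 0 < muA) (muB_gt0 : 0 < muB)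
    (beta_gt0 : 0 < beta) (beta_lt1 : beta < 1)
    (TA_gt0 : 0 < TA) (TA_lt_TB : TA < TB) (TB_le : TB <= 2 * TA)
    (alphaP : ionization_degrees muA muB beta TA TB alphaA alphaB)
    (SP : specific_entropy R M beta TA TB alphaA alphaB S)
    (p T : K) (p_gt0 : 0 < p) (T_gt0 : 0 < T) :
  let a := Num.sqrt (R / M) in
  let alpha := mean_ionization beta alphaA alphaB p T in
  let v := specific_volume R M beta alphaA alphaB in
  let eta := reduced_entropy R M S in
  let Sigma := Sigma_coef beta alphaA alphaB p T in
  let Phi := Phi_coef beta TA TB alphaA alphaB p T in
  let Psi := Psi_coef beta TA TB alphaA alphaB p T in
  let Omega := Omega_coef beta TA TB alphaA alphaB p T in
  let lambda := Num.sqrt (- (partial_T eta p T / vol_eta_jacobian v eta p T)) in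
  (forall x : K, characteristic_speed v eta p T x /\ x != 0
                 <-> x = lambda \/ x = - lambda) /\
  lambda = p / (a * Num.sqrt T * (1 + alpha))
           * Num.sqrt ((5 / 2 * (1 + alpha) * Sigma
                        + alpha * (1 + alpha) * Phi + Omega)
                       / (3 / 2 * Sigma + alpha * Psi + Omega)).
Proof.
move=> a alpha v eta Sigma Phi Psi Omega lambda.
have [R0 M0 p0 T0] : [/\ R != 0, M != 0, p != 0 & T != 0] by rewrite !gt_eqF.
have [/andP[a0 a1] /andP[b0 b1] _ _] := alphaP _ _ p_gt0 T_gt0.
pose cA := beta * (alphaA p T * (1 - alphaA p T)).
pose cB := (1 - beta) * (alphaB p T * (1 - alphaB p T)).
have cA0 : 0 < cA by rewrite !mulr_gt0 ?subr_gt0.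
have cB0 : 0 < cB by rewrite !mulr_gt0 ?subr_gt0.
have al0 : 0 < alpha.
  by rewrite /alpha /mean_ionization addr_gt0 ?mulr_gt0 ?subr_gt0.
have al1 : 0 < 1 + alpha by exact: addr_gt0.
have SigmaE : Sigma = alpha * (1 + alpha) + (cA + cB) by [].
have Sigma0 : 0 < Sigma by rewrite SigmaE !addr_gt0 // mulr_gt0.
have OmegaE : Omega = cA * cB * (TA / T - TB / T) ^+ 2.
  by rewrite /Omega /Omega_coef /cA /cB; ring.
have PsiE : Psi = cA * (15 / 4 + 3 * (TA / T) + (TA / T) ^+ 2)
                + cB * (15 / 4 + 3 * (TB / T) + (TB / T) ^+ 2).
  by rewrite /Psi /Psi_coef /cA /cB; field.
have PhiE : Phi = cA * (5 / 2 + TA / T) ^+ 2 + cB * (5 / 2 + TB / T) ^+ 2 by [].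
have Omega0 : 0 <= Omega.
  by rewrite OmegaE mulr_ge0 ?sqr_ge0 // ltW // mulr_gt0.
have Phi0 : 0 <= Phi.
  by rewrite PhiE addr_ge0 // mulr_ge0 ?sqr_ge0 // ltW.
have TB_gt0 : 0 < TB by exact: lt_trans TA_lt_TB.
have quad0 (z : K) : 0 < z -> 0 <= 15 / 4 + 3 * z + z ^+ 2.
  by move=> z0; rewrite !addr_ge0 ?sqr_ge0 // ?mulr_ge0 ?ltW.
have Psi0 : 0 <= Psi.
  by rewrite PsiE addr_ge0 // mulr_ge0 ?(ltW cA0) ?(ltW cB0) // quad0 // divr_gt0.
(* Numerator and denominator under the root. In each, the term with Sigma is strictly positive and
   the others are nonnegative. *)
set N := _ + Omega; set D := _ + Omega.
have N0 : 0 < N.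
  apply: ltr_wpDr => //; apply: ltr_wpDr; first by rewrite mulr_ge0 // ltW // mulr_gt0.
  by rewrite mulr_gt0 // mulr_gt0.
have D0 : 0 < D.
  apply: ltr_wpDr => //; apply: ltr_wpDr; first by rewrite mulr_ge0 // ltW.
  by rewrite mulr_gt0.
have [vp hp] := partial_p_volume_enthalpy R M muA muB beta TA TB alphaA alphaB
  p T muA_gt0 muB_gt0 beta_gt0 beta_lt1 M0 alphaP p_gt0 T_gt0.
have [vT hT] := partial_T_volume_enthalpy R M muA muB beta TA TB alphaA alphaB
  p T muA_gt0 muB_gt0 beta_gt0 beta_lt1 M0 alphaP p_gt0 T_gt0.
have [etap etaT] := entropy_partials _ _ _ _ _ _ _ _ _ _ _ SP p_gt0 T_gt0.
have SN0 : alpha * (1 + alpha) + (cA + cB) != 0 by rewrite -SigmaE gt_eqF.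
have etaTE : partial_T eta p T = N / (T * Sigma).
  rewrite etaT hT /N OmegaE PhiE SigmaE.
  exact: (etaT_closed_form _ _ _ _ _ _ _ _ _ R0 M0 T0 SN0).
have jacE : vol_eta_jacobian v eta p T =
    - (R / M * (1 + alpha) ^+ 2 / (p ^+ 2 * Sigma) * D).
  rewrite /vol_eta_jacobian etaT etap hT hp vp vT /D OmegaE PsiE SigmaE.
  exact: (jacobian_closed_form _ _ _ _ _ _ _ _ _ _ R0 M0 p0 T0 SN0).
have RM0 : 0 < R / M by exact: divr_gt0.
(* The factors Sigma of the two closed forms cancel, and a^2 = R / M. *)
have sqE : - (partial_T eta p T / vol_eta_jacobian v eta p T) =
    (p / (a * Num.sqrt T * (1 + alpha))) ^+ 2 * (N / D).
  rewrite etaTE jacE expr_div_n !exprMn !sqr_sqrtr ?ltW //.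
  by field; rewrite R0 M0 p0 T0 !gt_eqF.
have factor0 : 0 < p / (a * Num.sqrt T * (1 + alpha)).
  by rewrite divr_gt0 // !mulr_gt0 ?sqrtr_gt0.
have lambdaE : lambda = p / (a * Num.sqrt T * (1 + alpha)) * Num.sqrt (N / D).
  by rewrite /lambda sqE sqrtrM ?sqr_ge0 // sqrtr_sqr gtr0_norm.
have lambda0 : 0 < lambda by rewrite lambdaE mulr_gt0 // sqrtr_gt0 divr_gt0.
(* [Num.sqrt] is 0 on negative numbers, so squaring back requires the radicand to be nonnegative,
   which its factored form shows. *)
have lambda_sq : lambda ^+ 2 = - (partial_T eta p T / vol_eta_jacobian v eta p T).
  by rewrite sqr_sqrtr // sqE mulr_ge0 ?sqr_ge0 // divr_ge0 ?ltW.
split=> // x; rewrite /characteristic_speed /lagrangian_mx; split.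
- move=> [+ x0]; rewrite nonzero_eigenvalue_lagrangian // -lambda_sq eqf_sqr.
  by move=> /orP[] /eqP ->; [left|right].
- move=> xE; have x0 : x != 0.
    by case: xE => ->; rewrite ?oppr_eq0 gt_eqF.
  split=> //; rewrite nonzero_eigenvalue_lagrangian // -lambda_sq eqf_sqr.
  by case: xE => ->; rewrite eqxx ?orbT.
Qed.
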